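(* Let $Y$ be a mean zero random variable with variance $\sigma^2 \in (0,\infty)$ and moment generating function $m(s)=\mathbb{E}[e^{sY}]$, and let $Y^*$ have the $Y$-zero biased distribution and be defined on the same probability space as $Y$. (a) If $Y^*-Y \le c$ almost surely for some constant $c>0$ and $m(s)$ is finite for all $s\in[0,1/c)$, then for all $t\ge 0$, $$\mathbb{P}(Y\ge t)\le \exp\left(-\frac{t^2}{2(\sigma^2+ct)}\right).$$ The same upper bound holds for $\mathbb{P}(Y\le -t)$, $t \ge 0$, if $Y-Y^*\le c$ almost surely and $m(s)$ is finite for all $s\in(-1/c,0]$. If $|Y^*-Y|\le c$ almost surely for some $c>0$ and $m(s)$ is finite for all $s\in[0,2/c)$, then for all $t\ge0$, $$\mathbb{P}(Y\ge t)\le \exp\left(-\frac{t^2}{10\sigma^2/3+ct}\right),$$ and the same upper bound holds for $\mathbb{P}(Y\le -t)$ if $|Y^*-Y|\le c$ almost surely and $m(s)$ is finite for all $s\in(-2/c,0]$. (b) Let $t>e$ and $\theta=(\log t-\log\log t)/c$. If $Y^*-Y\le c$ almost surely for some constant $c>0$ and $m(\theta)$ is finite, then $$\mathbb{P}(Y\ge t)\le \exp\left(-\frac{t}{c}\left(\log t-\log\log t-\frac{\sigma^2}{c}\right)\right)\le \exp\left(-\frac{t}{2c}\left(\log t-\frac{2\sigma^2}{c}\right)\right).$$ If $Y-Y^*\le c$ almost surely and $m(-\theta)$ is finite, the same bound holds for $\mathbb{P}(Y\le -t)$.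
   Context: Zero bias distribution: for a mean zero random variable $Y$ with finite positive variance $\sigma^2$, a random variable $Y^*$ is said to have the $Y$-zero biased distribution if $\mathbb{E}[Yf(Y)]=\sigma^2\mathbb{E}[f'(Y^* )]$ for all absolutely continuous functions $f$ for which the expectation of either side exists. Such a distribution always exists. ''Defined on the same space'' means $(Y,Y^* )$ is a coupling, i.e. a pair of random variables on a common probability space with the given marginal laws. *)

(* Defs.v *)
From HB Require Import structures.
From mathcomp Require Import all_boot all_order all_algebra.
From mathcomp Require Import all_classical all_reals all_analysis.
Set Implicit Arguments. Unset Strict Implicit. Unset Printing Implicit Defensive.
Import Order.TTheory GRing.Theory Num.Theory.
Local Open Scope classical_set_scope.
Local Open Scope ring_scope.

Definition abs_cont_deriv (R : realType) (f g : R -> R) : Prop :=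
  forall a b : R, a <= b ->
    (lebesgue_measure).-integrable `[a, b] (EFin \o g) /\
    ((f b - f a)%:E = \int[lebesgue_measure]_(x in `[a, b]) (g x)%:E)%E.

Definition zero_biased d (T : measurableType d) (R : realType)
  (P : probability T R) (Y Ys : T -> R) (s2 : R) : Prop :=
  forall f g : R -> R, abs_cont_deriv f g ->
    P.-integrable setT (EFin \o (fun w => Y w * f (Y w))%R) ->
    P.-integrable setT (EFin \o (fun w => g (Ys w))%R) ->
    ('E_P[(fun w => Y w * f (Y w))%R] = s2%:E * 'E_P[(fun w => g (Ys w))%R])%E.

(* Main.v *)
(* Write m(s) = E[e^(sX)]. The zero bias identity for the test function
   x |-> e^(sx), together with Xs <= X + c, gives the differential inequality
   m'(s) = E[X e^(sX)] = s2 s E[e^(s Xs)] <= s2 s e^(cs) m(s). Hence m e^(-G) is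
   nonincreasing as soon as G'(s) >= s2 s e^(cs), and P(X >= t) <= e^(G(s) - st)
   by Chernoff. The three bounds come from three choices of G:
   - s2 s^2 / (2 (1 - cs)), using e^x <= 1 / (1 - x) with x = cs;
   - (5/6) s2 s^2 / (1 - cs/2), using e^(2x) <= (1 + x) / (1 - x) with x = cs/2;
     only the one-sided bound Xs - X <= c is needed here too;
   - (s2 theta / c) (e^(cs) - 1) on [0, theta], letting s tend to theta from
     below in the resulting tail bound, so that m(theta) is never estimated.
   Lower tails follow by applying this to (- Y, - Ys). *)
Require Import Defs.
From HB Require Import structures.
From mathcomp Require Import all_boot all_order all_algebra.
From mathcomp Require Import all_classical all_reals all_analysis.
From mathcomp Require Import measurable_realfun lebesgue_integral_under ring lra.
Set Implicit Arguments.
Unset Strict Implicit.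
Unset Printing Implicit Defensive.
Import Order.TTheory GRing.Theory Num.Theory numFieldNormedType.Exports.
Local Open Scope classical_set_scope.
Local Open Scope ring_scope.

(** * Exponential test functions *)

Lemma is_derive_expRM (R : realType) (c x : R) :
  is_derive x 1 (fun s => expR (c * s)) (c * expR (c * x)).
Proof.
have -> : (fun s => expR (c * s)) = expR \o (c \*: id) by [].
by apply: is_derive_eq; rewrite /GRing.scale /=; ring.
Qed.

Lemma abs_cont_deriv_expRM (R : realType) (c : R) :
  abs_cont_deriv (fun x => expR (c * x)) (fun x => c * expR (c * x)).
Proof.
have dF x := @ex_derive _ _ _ _ _ _ _ (is_derive_expRM c x).
have cF : continuous (fun x : R => expR (c * x)).
  by move=> x; exact/differentiable_continuous/derivable1_diffP.
have cf : continuous (fun x : R => c * expR (c * x)).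
  by move=> x; apply: cvgMr; exact: cF.
move=> a b ab; split.
  apply: continuous_compact_integrable; first exact: segment_compact.
  exact: continuous_subspaceT.
move: ab; rewrite le_eqVlt => /predU1P[<-|ab].
  by rewrite subrr set_itv1 integral_set1.
rewrite (@continuous_FTC2 _ _ (fun x => expR (c * x)))//.
- exact: continuous_subspaceT.
- split; first by move=> x _; exact: dF.
  + exact: cvg_at_right_filter (cF a).
  + exact: cvg_at_left_filter (cF b).
- by move=> x _; rewrite derive1E (@derive_val _ _ _ _ _ _ _ (is_derive_expRM c x)).
Qed.

(** A majorant independent of [s] in [[0, v]]. For [x <= 0] the exponential is at most 1; for
    [x > 0], [(s0 - v) x <= (s0 - s) x <= e^((s0 - s) x)], so the gap below [s0] absorbs the factor
    [x]. *)
Lemma norm_mul_expR_le (R : realType) (s v s0 x : R) : 0 <= s -> s <= v -> v < s0 ->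
  `|x * expR (s * x)| <= `|x| + (s0 - v)^-1 * expR (s0 * x).
Proof.
move=> s_ge0 sv vs0; have d_gt0 : 0 < s0 - v by rewrite subr_gt0.
rewrite normrM (ger0_norm (expR_ge0 _)); have [x0|x0] := leP x 0.
  apply: ler_wpDr; first by rewrite mulr_ge0 ?expR_ge0// invr_ge0 ltW.
  by rewrite ler_piMr// -expR0 ler_expR mulr_ge0_le0.
rewrite ler_wpDl// gtr0_norm// ler_pdivlMl// mulrA.
have -> : s0 * x = (s0 - s) * x + s * x by ring.
rewrite expRD ler_pM2r ?expR_gt0//.
apply: (@le_trans _ _ (1 + (s0 - s) * x)); last exact: expR_ge1Dx.
rewrite ler_wpDl// ler_pM2r//; lra.
Qed.

(** * Moment generating function: integrability, derivative, Chernoff bound *)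

Section exponential_tilting.
Context d (T : measurableType d) (R : realType) (P : probability T R).
Variable X : T -> R.
Hypothesis mX : measurable_fun setT X.

Lemma measurable_expRM (s : R) : measurable_fun setT (fun w => expR (s * X w)).
Proof. by apply: measurableT_comp => //; exact: measurable_funM. Qed.

Lemma mmt_gen_funE (s : R) : ('M_P X s = \int[P]_w (expR (s * X w))%:E)%E.
Proof.
rewrite /mmt_gen_fun unlock; apply: eq_integral => w _ /=.
by rewrite mulrC.
Qed.

Lemma integrable_expRM (s : R) : ('M_P X s < +oo)%E ->
  P.-integrable setT (fun w => (expR (s * X w))%:E).
Proof.
move=> Ms; apply/integrableP; split.
  exact/measurable_EFinP/measurable_expRM.
move: Ms; rewrite mmt_gen_funE; congr (_ < _)%E.
by apply: eq_integral => w _; rewrite /= ger0_norm// expR_ge0.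
Qed.

(** Since [e^(sx) <= 1 + e^(s0 x)], finiteness at the single point [s0] covers all of [[0, s0]]; the
    logarithmic bound assumes finiteness only at [theta]. *)
Lemma integrable_expRM_le (s s0 : R) : 0 <= s <= s0 -> ('M_P X s0 < +oo)%E ->
  P.-integrable setT (fun w => (expR (s * X w))%:E).
Proof.
move=> /andP[s_ge0 ss0] /integrable_expRM Ms0.
apply: (@le_integrable _ _ _ P _ measurableT _ (fun w => (1 + expR (s0 * X w))%:E)).
- exact/measurable_EFinP/measurable_expRM.
- move=> w _; rewrite lee_fin !ger0_norm ?addr_ge0 ?expR_ge0//.
  have [Xw|Xw] := leP (X w) 0.
    by rewrite ler_wpDr ?expR_ge0// -expR0 ler_expR mulr_ge0_le0.
  by rewrite ler_wpDl// ler_expR ler_wpM2r// ltW.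
- under eq_fun do rewrite EFinD.
  by apply: integrableD => //; exact: finite_measure_integrable_cst.
Qed.

Hypothesis iX : P.-integrable setT (EFin \o X).
Variable s0 : R.
Hypothesis Ms0 : ('M_P X s0 < +oo)%E.

Let dominant (v : R) (w : T) : R := `|X w| + (s0 - v)^-1 * expR (s0 * X w).

Let integrable_dominant (v : R) : P.-integrable setT (EFin \o dominant v).
Proof.
rewrite /dominant /comp; under eq_fun do rewrite EFinD.
apply: integrableD => //; first exact: integrable_norm.
under eq_fun do rewrite EFinM.
by apply: integrableZl => //; exact: integrable_expRM.
Qed.

Lemma integrable_tilt (s : R) : 0 <= s < s0 ->
  P.-integrable setT (fun w => (X w * expR (s * X w))%:E).
Proof.
move=> /andP[s_ge0 ss0].
apply: (@le_integrable _ _ _ P _ measurableT _ (EFin \o dominant s)) => //.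
  by apply/measurable_EFinP/measurable_funM => //; exact: measurable_expRM.
move=> w _; rewrite lee_fin (le_trans (norm_mul_expR_le (X w) s_ge0 _ ss0))//.
exact: ler_norm.
Qed.

Lemma is_derive_mgf (s : R) : 0 < s < s0 ->
  is_derive s 1 (fun s => \int[P]_w expR (s * X w))
    (\int[P]_w (X w * expR (s * X w))).
Proof.
(* The midpoint [v] leaves an open neighbourhood []0, v[] of [s] on which [dominant v] bounds all
   derivatives in the parameter. *)
move=> /andP[s_gt0 ss0]; pose v := (s + s0) / 2.
have vs0 : v < s0 by rewrite /v; lra.
have sv : `]0, v[%classic s by rewrite /= in_itv /= s_gt0 /v; lra.
have dE y (x : R) : is_derive x 1 (fun u => expR (u * X y)) (X y * expR (x * X y)).
  under eq_fun do rewrite mulrC.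
  by apply: is_derive_eq (is_derive_expRM (X y) x) _; rewrite [x * _]mulrC.
have int_f x : `]0, v[%classic x ->
    P.-integrable setT (EFin \o (fun w => expR (x * X w))).
  rewrite /= in_itv /= => /andP[x0 xv].
  by apply: (integrable_expRM_le _ Ms0); rewrite ltW//= ltW// (lt_trans xv).
have der_f (x : R) (y : T) : `]0, v[%classic x -> setT y -> derivable (fun u : R => expR (u * X y)) x 1.
  by move=> _ _; exact: (@ex_derive _ _ _ _ _ _ _ (dE y x)).
have dom_ge0 y : 0 <= dominant v y.
  by rewrite addr_ge0// mulr_ge0 ?expR_ge0// invr_ge0; lra.
have d1E (x : R) y : partial1of2 (fun (u : R) w => expR (u * X w)) x y = X y * expR (x * X y).
  by rewrite partial1of2E (@derive_val _ _ _ _ _ _ _ (dE y x)).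
have dom (x : R) (y : T) : `]0, v[%classic x -> setT y ->
    `|partial1of2 (fun (u : R) w => expR (u * X w)) x y| <= dominant v y.
  rewrite /= in_itv /= => /andP[x0 xv] _; rewrite d1E.
  by apply: norm_mul_expR_le => //; exact: ltW.
apply: DeriveDef.
  exact: (derivable_under_integral measurableT sv int_f der_f dom_ge0
    (integrable_dominant v) dom).
rewrite -derive1E (differentiation_under_integral measurableT sv int_f der_f dom_ge0
  (integrable_dominant v) dom).
by apply: eq_Rintegral => w _; rewrite d1E.
Qed.

(** From [1 - y <= e^(-y)] one gets [e^y <= 1 + y e^y]; take [y = s X] and bound [X e^(sX)] by the
    majorant, whose expectation is [C]. *)
Lemma mgf_le_linear (v : R) : v < s0 -> exists C : R, forall s, 0 <= s <= v ->
  \int[P]_w expR (s * X w) <= 1 + s * C.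
Proof.
move=> vs0; exists (\int[P]_w dominant v w) => s /andP[s_ge0 sv].
have -> : 1 + s * \int[P]_w dominant v w = \int[P]_w (1 + s * dominant v w).
  rewrite [RHS]RintegralD//.
  - rewrite [X in _ = _ + X]RintegralZl ?Rintegral_cst//.
    by rewrite [X in fine X]probability_setT mul1r.
  - exact: finite_measure_integrable_cst.
  - exact: (integrableZl measurableT s (integrable_dominant v)).
apply: le_Rintegral => //.
- by apply: (integrable_expRM_le _ Ms0); rewrite s_ge0/=; lra.
- rewrite /comp; under eq_fun do rewrite EFinD EFinM.
  apply: integrableD => //; first exact: finite_measure_integrable_cst.
  exact: (integrableZl measurableT s (integrable_dominant v)).
move=> w _; have := norm_mul_expR_le (X w) s_ge0 sv vs0.
move=> /(le_trans (ler_norm _)) /(ler_wpM2l s_ge0); rewrite -/(dominant v w) => le_dom.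
apply: le_trans (_ : 1 + s * (X w * expR (s * X w)) <= _); last by rewrite lerD2l.
have := expR_ge1Dx (- (s * X w)); rewrite -(ler_pM2r (expR_gt0 (s * X w))).
by rewrite -expRD addNr expR0 mulrDl mul1r; lra.
Qed.

(* Monotonicity is only available on the open interval (the mgf need not be
   differentiable at 0); [mgf_le_linear] supplies the limit at 0+. *)
Lemma mgf_le_expR (K G g : R -> R) :
  (forall s, 0 < s < s0 -> \int[P]_w (X w * expR (s * X w)) <=
    K s * \int[P]_w expR (s * X w)) ->
  (forall s, 0 < s < s0 -> is_derive s 1 G (g s)) ->
  (forall s, 0 < s < s0 -> K s <= g s) ->
  (forall s, 0 < s < s0 -> 0 <= G s) ->
  forall s, 0 < s < s0 -> \int[P]_w expR (s * X w) <= expR (G s).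
Proof.
move=> mK dG Kg G_ge0 s /andP[s_gt0 ss0].
pose m u := \int[P]_w expR (u * X w).
have m_ge0 u : 0 <= m u by apply: Rintegral_ge0 => w _; exact: expR_ge0.
pose h u := m u * expR (- G u).
have dh u : 0 < u < s0 -> is_derive u 1 h
    ((\int[P]_w (X w * expR (u * X w)) - g u * m u) * expR (- G u)).
  move=> us; have dm := is_derive_mgf us; have dGu := dG u us.
  have dN : is_derive u 1 (fun v => expR (- G v)) (- g u * expR (- G u)).
    have -> : (fun v => expR (- G v)) = expR \o (- G) by [].
    by apply: is_derive_eq; exact: mulrC.
  apply: is_derive_eq (is_deriveM dm dN) _.
  by rewrite /GRing.scale /m /=; ring.
have h_nincr : {in `]0, s0[ &, {homo h : x y /~ x <= y}}.
  have dho u : u \in `]0, s0[ -> derivable h u 1.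
    by rewrite in_itv /= => us; exact: (@ex_derive _ _ _ _ _ _ _ (dh u us)).
  apply: ler0_derive1_le_oo => //.
  - move=> u; rewrite in_itv /= => us.
    rewrite derive1E (@derive_val _ _ _ _ _ _ _ (dh u us)).
    rewrite pmulr_lle0 ?expR_gt0// subr_le0 (le_trans (mK u us))//.
    exact: ler_wpM2r (m_ge0 u) _ _ (Kg u us).
  - move=> u; rewrite inE => us.
    exact/differentiable_continuous/derivable1_diffP/dho.
(* The goal becomes [h s <= 1], shown up to an arbitrary [e > 0] through
   [h s <= h u <= m u <= 1 + u C <= 1 + e] for a small [u]. *)
rewrite -[leRHS]mul1r -ler_pdivrMr ?expR_gt0// -expRN -/(m s) -/(h s).
have [C mC] := mgf_le_linear ss0.
apply/ler_addgt0Pr => e e_gt0.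
pose u := Num.min s (e / (1 + `|C|)).
have C_gt0 : 0 < 1 + `|C| by rewrite ltr_pwDl.
have u_gt0 : 0 < u by rewrite lt_min s_gt0 divr_gt0.
have us : u <= s by rewrite ge_min lexx.
have u_lt : 0 < u < s0 by rewrite u_gt0 (le_lt_trans us).
apply: (@le_trans _ _ (h u)).
  by apply: h_nincr => //; rewrite in_itv//= s_gt0.
apply: (@le_trans _ _ (m u)).
  by rewrite ler_piMr// -expR0 ler_expR oppr_le0 G_ge0.
apply: (le_trans (mC u _)); first by rewrite us ltW.
rewrite lerD2l (@le_trans _ _ (u * (1 + `|C|)))//.
  by rewrite ler_pM2l// (le_trans (ler_norm _))// lerDr.
by rewrite -ler_pdivlMr// ge_min lexx orbT.
Qed.

Lemma chernoff_expR (s t b : R) : 0 < s < s0 ->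
  \int[P]_w expR (s * X w) <= expR b ->
  (P [set w | (t <= X w)%R] <= (expR (b - s * t))%:E)%E.
Proof.
move=> /andP[s_gt0 ss0] mb.
pose X' : {RV P >-> R} := HB.pack X (isMeasurableFun.Build _ _ _ _ X mX).
apply: (le_trans (chernoff X' t s_gt0)).
rewrite expRD EFinM.
have is_ : P.-integrable setT (fun w => (expR (s * X w))%:E).
  by apply: (integrable_expRM_le _ Ms0); rewrite !ltW.
apply: lee_wpmul2r; first by rewrite lee_fin expR_ge0.
rewrite mmt_gen_funE.
by rewrite -(fineK (integrable_fin_num measurableT is_)) lee_fin.
Qed.

End exponential_tilting.

(* Of the zero bias identity, only the test functions [x |-> expR (s * x)] are
   used; in this form it is stable under [(X, Xs) |-> (- X, - Xs)]. *)
Definition exp_zero_biased d (T : measurableType d) (R : realType)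
    (P : probability T R) (X Xs : T -> R) (s2 : R) : Prop :=
  forall s : R,
    P.-integrable setT (fun w => (X w * expR (s * X w))%:E) ->
    P.-integrable setT (fun w => (expR (s * Xs w))%:E) ->
    \int[P]_w (X w * expR (s * X w)) = s2 * s * \int[P]_w expR (s * Xs w).

(** * Exponential zero bias identity and its reflection *)

Section exp_zero_biased.
Context d (T : measurableType d) (R : realType) (P : probability T R).

Lemma zero_biased_exp (X Xs : T -> R) (s2 : R) :
  zero_biased P X Xs s2 -> exp_zero_biased P X Xs s2.
Proof.
move=> zb s iX iXs.
have isXs : P.-integrable setT (EFin \o (fun w => s * expR (s * Xs w))).
  by rewrite /comp; under eq_fun do rewrite EFinM; exact: integrableZl.
have := zb _ _ (abs_cont_deriv_expRM s) iX isXs.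
rewrite unlock /Rintegral => ->.
rewrite -(fineK (integrable_fin_num measurableT isXs)) -EFinM /=.
by rewrite -/(Rintegral _ _ _) RintegralZl// mulrA.
Qed.

(** The identity for the reflected pair at [s] is the original one at [- s] with both sides
    negated. *)
Lemma exp_zero_biasedN (X Xs : T -> R) (s2 : R) :
  exp_zero_biased P X Xs s2 -> exp_zero_biased P (\- X) (\- Xs) s2.
Proof.
have E (Z : T -> R) s w : s * - Z w = - s * Z w by rewrite mulrN mulNr.
move=> zb s /=; under eq_fun do rewrite E.
under [in X in _ -> X -> _]eq_fun do rewrite E.
move=> iX iXs; under eq_Rintegral do rewrite E.
under [in RHS]eq_Rintegral do rewrite E.
have iX' : P.-integrable setT (fun w => (X w * expR (- s * X w))%:E).
  apply: eq_integrable (integrableZl measurableT (-1) iX) => // w _.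
  by rewrite -EFinM; congr EFin; ring.
have := zb (- s) iX' iXs; rewrite mulrN mulNr => /(congr1 -%R).
rewrite opprK => <-; rewrite -[RHS]mulN1r -RintegralZl//.
by apply: eq_Rintegral => w _ /=; rewrite mulN1r [LHS]mulNr.
Qed.

End exp_zero_biased.

(** * From a majorant of the log-mgf to a tail bound *)

Lemma is_derive_subgamma (R : realType) (k b s : R) : 1 - b * s != 0 ->
  is_derive s 1 (fun s => k * s ^+ 2 / (1 - b * s))
    (k * s * (2 - b * s) / (1 - b * s) ^+ 2).
Proof.
move=> bs.
have dd : is_derive s 1 (fun s => 1 - b * s) (- b).
  have -> : (fun s => 1 - b * s) = cst 1 - (b \*: id) by [].
  by apply: is_derive_eq; rewrite /GRing.scale /=; ring.
have dn : is_derive s 1 (fun s => k * s ^+ 2) (k * (2 * s)).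
  have -> : (fun s => k * s ^+ 2) = k \*: (id ^+ 2) by apply/funext.
  by apply: is_derive_eq; rewrite /GRing.scale /= ; ring.
have := is_deriveM dn (is_deriveV (f := fun s => 1 - b * s) bs dd).
move=> /is_derive_eq; apply; rewrite /GRing.scale /=.
by field.
Qed.

Section zero_bias_tail.
Context d (T : measurableType d) (R : realType) (P : probability T R).
Variables (X Xs : T -> R) (s2 c : R).
Hypothesis mX : measurable_fun setT X.
Hypothesis mXs : measurable_fun setT Xs.
Hypothesis iX : P.-integrable setT (EFin \o X).
Hypothesis zb : exp_zero_biased P X Xs s2.
Hypothesis s2_gt0 : 0 < s2.
Hypothesis c_gt0 : 0 < c.
Hypothesis XsX : {ae P, forall w, Xs w - X w <= c}.

(** The coupling gives [e^(s Xs) <= e^(cs) e^(sX)] almost surely. This is used twice: for the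
    integrability of [e^(s Xs)], which the zero bias identity requires, and for the estimate
    itself. *)
Lemma tilted_mean_le (s0 s : R) : ('M_P X s0 < +oo)%E -> 0 < s < s0 ->
  \int[P]_w (X w * expR (s * X w)) <=
  s2 * s * expR (c * s) * \int[P]_w expR (s * X w).
Proof.
move=> Ms0 /andP[s_gt0 ss0].
have iE : P.-integrable setT (fun w => (expR (s * X w))%:E).
  by apply: (integrable_expRM_le mX _ Ms0); rewrite !ltW.
have icE : P.-integrable setT (fun w => (expR (c * s) * expR (s * X w))%:E).
  by under eq_fun do rewrite EFinM; exact: integrableZl.
have mE (Z : T -> R) : measurable_fun setT Z -> measurable_fun setT (fun w => (expR (s * Z w))%:E).
  by move=> mZ; exact/measurable_EFinP/measurable_expRM.
have le_int : (\int[P]_w (expR (s * Xs w))%:E <=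
               \int[P]_w (expR (c * s) * expR (s * X w))%:E)%E.
  apply: ae_ge0_le_integral => //.
  - exact: (mE _ mXs).
  - by case/integrableP: icE.
  apply: filterS XsX => w XsXw _; rewrite lee_fin -expRD ler_expR.
  by rewrite [c * s]mulrC -mulrDr ler_pM2l//; lra.
have fE := integrable_fin_num measurableT icE.
have iEs : P.-integrable setT (fun w => (expR (s * Xs w))%:E).
  apply/integrableP; split; first exact: (mE _ mXs).
  under eq_integral do rewrite /= ger0_norm ?expR_ge0//.
  by rewrite (le_lt_trans le_int)// ltey_eq fE.
have is_ : 0 <= s < s0 by rewrite ltW.
rewrite (zb (integrable_tilt mX iX Ms0 is_) iEs).
rewrite -[leRHS]mulrA ler_pM2l ?mulr_gt0// -RintegralZl// /Rintegral fine_le//.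
exact: integrable_fin_num.
Qed.

Lemma zero_bias_chernoff (s0 t : R) (G g : R -> R) : ('M_P X s0 < +oo)%E ->
  (forall s, 0 < s < s0 -> is_derive s 1 G (g s)) ->
  (forall s, 0 < s < s0 -> s2 * s * expR (c * s) <= g s) ->
  (forall s, 0 < s < s0 -> 0 <= G s) ->
  forall s, 0 < s < s0 ->
  (P [set w | (t <= X w)%R] <= (expR (G s - s * t))%:E)%E.
Proof.
move=> Ms0 dG Kg G_ge0 s ss0.
apply: (chernoff_expR mX Ms0 _ ss0).
apply: (mgf_le_expR mX iX Ms0 _ dG Kg G_ge0 ss0).
by move=> u us0; exact: tilted_mean_le Ms0 us0.
Qed.

(** Bernstein-type bound from [G(s) = k s^2 / (1 - bs)]; the hypothesis on [k] and [b] is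
    [G'(s) >= s2 s e^(cs)] divided by [s]. *)
Lemma subgamma_tail (k b : R) : 0 < k -> 0 < b ->
  (forall s, 0 < s < b^-1 -> s2 * expR (c * s) <= k * (2 - b * s) / (1 - b * s) ^+ 2) ->
  (forall s, 0 <= s < b^-1 -> ('M_P X s < +oo)%E) ->
  forall t, 0 <= t ->
  (P [set w | (t <= X w)%R] <= (expR (- (t ^+ 2 / (2 * (2 * k + b * t)))))%:E)%E.
Proof.
(* At [t = 0] the parameter chosen below would be 0, outside the open interval; there the claimed
   bound is just 1. *)
move=> k_gt0 b_gt0 Kg M t; rewrite le_eqVlt => /predU1P[<-|t_gt0].
  rewrite expr0n/= mul0r oppr0 expR0; apply: probability_le1.
  by rewrite -[X in measurable X]setTI; exact: measurable_fun_le.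
have D_gt0 : 0 < 2 * k + b * t by rewrite addr_gt0 ?mulr_gt0.
(* With this choice [1 - bs = 2k / (2k + bt)], so [G(s)] is exactly half of [s t], and the exponent
   is [- s t / 2]. *)
pose s := t / (2 * k + b * t).
have s_gt0 : 0 < s by rewrite divr_gt0.
have s_lt : s < b^-1.
  rewrite ltr_pdivrMr// mulrDr mulKf ?gt_eqF// ltrDr.
  by rewrite mulr_gt0 ?invr_gt0// mulr_gt0.
(* A point strictly between [s] and [1/b], where the mgf is finite by assumption. *)
pose s0 := (s + b^-1) / 2.
have s0_lt : s0 < b^-1 by rewrite /s0; lra.
have ss0 : 0 < s < s0 by rewrite s_gt0 /s0; lra.
have bs u : 0 < u < s0 -> 0 < 1 - b * u.
  move=> /andP[_ us0]; rewrite subr_gt0 -ltr_pdivlMl// mulr1.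
  exact: lt_trans s0_lt.
have Ms0 : ('M_P X s0 < +oo)%E by apply: M; rewrite s0_lt andbT /s0; lra.
have -> : - (t ^+ 2 / (2 * (2 * k + b * t))) = k * s ^+ 2 / (1 - b * s) - s * t.
  by rewrite /s; field; rewrite ?gt_eqF//; lra.
apply: (zero_bias_chernoff t (G := fun s => k * s ^+ 2 / (1 - b * s))
  (g := fun s => k * s * (2 - b * s) / (1 - b * s) ^+ 2) Ms0) => // u us0.
- apply: is_derive_subgamma; rewrite gt_eqF//; exact: bs us0.
- have u_gt0 : 0 < u by case/andP: us0.
  have /Kg : 0 < u < b^-1 by rewrite u_gt0 (lt_trans _ s0_lt)//; case/andP: us0.
  by rewrite -(ler_pM2l u_gt0); congr (_ <= _); ring.
- by apply: divr_ge0; [rewrite mulr_ge0 ?sqr_ge0 ?ltW|exact: ltW (bs _ us0)].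
Qed.

End zero_bias_tail.

(** * Scalar exponential inequalities *)

Lemma expR_mulB1 (R : realType) (x : R) : expR x * (1 - x) <= 1.
Proof.
have := expR_ge1Dx (- x); rewrite -(ler_pM2l (expR_gt0 x)).
by rewrite -expRD subrr expR0.
Qed.

(** The claim is [p x >= -1 = p 0], and [p] is nondecreasing because [p'(y) = 1 - e^(2y) (1 - 2y)]
    is nonnegative by [expR_mulB1] at [2y]. *)
Lemma expR_2M_mulB1 (R : realType) (x : R) : 0 <= x ->
  expR (2 * x) * (1 - x) <= 1 + x.
Proof.
move=> x_ge0; pose p (y : R) := y + expR (2 * y) * (y - 1).
have dp (y : R) : is_derive y 1 p (1 - expR (2 * y) * (1 - 2 * y)).
  have d1 : is_derive y 1 (fun z : R => z - 1) 1.
    have -> : (fun z : R => z - 1) = id - cst 1 by [].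
    by apply: is_derive_eq; rewrite subr0.
  apply: is_derive_eq (is_deriveD (is_derive_id y 1)
    (is_deriveM (is_derive_expRM 2 y) d1)) _.
  by rewrite /GRing.scale /=; ring.
have dp' y : derivable p y 1 by exact: (@ex_derive _ _ _ _ _ _ _ (dp y)).
have : p 0 <= p x.
  apply: (@ger0_derive1_le_cc _ p 0 x) => //; rewrite ?in_itv/= ?lexx ?x_ge0//.
  - by move=> y _; rewrite derive1E (@derive_val _ _ _ _ _ _ _ (dp y)) subr_ge0 expR_mulB1.
  - by apply: derivable_within_continuous => y _.
by rewrite /p mulr0 expR0; lra.
Qed.

(** * The three upper tail bounds *)

Section zero_bias_concentration.
Context d (T : measurableType d) (R : realType) (P : probability T R).
Variables (X Xs : T -> R) (s2 c : R).
Hypothesis mX : measurable_fun setT X.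
Hypothesis mXs : measurable_fun setT Xs.
Hypothesis iX : P.-integrable setT (EFin \o X).
Hypothesis zb : exp_zero_biased P X Xs s2.
Hypothesis s2_gt0 : 0 < s2.
Hypothesis c_gt0 : 0 < c.
Hypothesis XsX : {ae P, forall w, Xs w - X w <= c}.

Lemma zero_bias_subgamma : (forall s : R, 0 <= s < c^-1 -> ('M_P X s < +oo)%E) ->
  forall t : R, 0 <= t ->
  (P [set w | (t <= X w)%R] <= (expR (- (t ^+ 2 / (2 * (s2 + c * t)))))%:E)%E.
Proof.
move=> M t t_ge0.
(* Apply the sub-gamma bound with [k = s2 / 2], [b = c]. With [x = cs] its condition follows from
   [e^x (1 - x) <= 1] and [1 - x <= (2 - x) / 2]. *)
have -> : s2 + c * t = 2 * (s2 / 2) + c * t by field.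
apply: (subgamma_tail mX mXs iX zb s2_gt0 XsX) => //; first by rewrite divr_gt0.
move=> s /andP[s_gt0 sc].
have x_gt0 : 0 < c * s by rewrite mulr_gt0.
have x_lt1 : c * s < 1 by rewrite -ltr_pdivlMl// mulr1.
set x := c * s in x_gt0 x_lt1 *.
rewrite ler_pdivlMr ?exprn_gt0 ?subr_gt0//.
have sx_gt0 : 0 < s2 * (1 - x) by rewrite mulr_gt0// subr_gt0.
by have := expR_mulB1 x; rewrite -(ler_pM2l sx_gt0); nra.
Qed.

Lemma zero_bias_subgamma_half : (forall s : R, 0 <= s < 2 / c -> ('M_P X s < +oo)%E) ->
  forall t : R, 0 <= t ->
  (P [set w | (t <= X w)%R] <= (expR (- (t ^+ 2 / (10 * s2 / 3 + c * t))))%:E)%E.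
Proof.
move=> M t t_ge0.
(* Here [k = 5 s2 / 6] and [b = c / 2], so that [4k = 10 s2 / 3] and [2b = c]. *)
have -> : 10 * s2 / 3 + c * t = 2 * (2 * (5 / 6 * s2) + c / 2 * t) by field.
apply: (subgamma_tail mX mXs iX zb s2_gt0 XsX) => //.
- by rewrite mulr_gt0.
- by rewrite divr_gt0.
- move=> s /andP[s_gt0 sc].
  have x_gt0 : 0 < c / 2 * s by rewrite mulr_gt0// divr_gt0.
  have x_lt1 : c / 2 * s < 1 by rewrite -ltr_pdivlMl ?divr_gt0// mulr1.
  have -> : c * s = 2 * (c / 2 * s) by field.
  set x := c / 2 * s in x_gt0 x_lt1 *.
  rewrite ler_pdivlMr ?exprn_gt0 ?subr_gt0//.
  have sx_gt0 : 0 < s2 * (1 - x) by rewrite mulr_gt0// subr_gt0.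
  have := expR_2M_mulB1 (ltW x_gt0); rewrite -(ler_pM2l sx_gt0).
  (* What remains is [1 - x^2 <= (5/6) (2 - x)], that is [x^2 - 5x/6 + 2/3 >= 0]; its vertex is at
     [5/12]. *)
  by have := sqr_ge0 (x - 5 / 12); nra.
- by move=> s; rewrite invf_div; exact: M.
Qed.

Lemma zero_bias_log_tail (t : R) : expR 1 < t ->
  ('M_P X ((ln t - ln (ln t)) / c) < +oo)%E ->
  (P [set w | (t <= X w)%R] <=
     (expR (- (t / c * (ln t - ln (ln t) - s2 / c))))%:E)%E.
Proof.
set th := (ln t - ln (ln t)) / c => te Mth.
have t_gt0 : 0 < t by rewrite (lt_trans (expR_gt0 1)).
have L_gt1 : 1 < ln t by rewrite -[ltLHS]expRK ltr_ln// posrE expR_gt0.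
have L_gt0 : 0 < ln t by rewrite (lt_trans ltr01).
have th_gt0 : 0 < th by rewrite divr_gt0// subr_gt0 ln_sublinear.
have lnL_ge0 : 0 <= ln (ln t) by rewrite ln_ge0// ltW.
have eth : expR (c * th) = t / ln t.
  by rewrite mulrC divfK ?gt_eqF// expRB !lnK ?posrE.
have k_ge0 : 0 <= s2 * th / c by rewrite ltW// divr_gt0// mulr_gt0.
(* Bounding the factor [s] by [th] in [s2 s e^(cs)] leaves an exponential with this explicit
   primitive vanishing at 0. *)
pose G s := s2 * th / c * (expR (c * s) - 1).
have tail s : 0 < s < th -> (P [set w | (t <= X w)%R] <= (expR (G s - s * t))%:E)%E.
  apply: (zero_bias_chernoff mX mXs iX zb s2_gt0 XsX _ Mth
    (g := fun s => s2 * th * expR (c * s))) => u /andP[u_gt0 uth].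
  - have -> : G = (s2 * th / c) \*: (fun s => expR (c * s)) - cst (s2 * th / c).
      by apply/funext => v; rewrite /G mulrBr mulr1.
    have dE := is_derive_expRM c u.
    apply: is_derive_eq; rewrite /GRing.scale /= subr0.
    by field; rewrite gt_eqF.
  - by rewrite ler_pM2r ?expR_gt0// ler_pM2l// ltW.
  - rewrite /G mulr_ge0// subr_ge0.
    by rewrite -expR0 ler_expR ltW// mulr_gt0.
(* At [th], [e^(c th) = t / ln t] and [th <= ln t / c] (as [ln (ln t) >= 0]) give
   [G th <= s2 t / c^2]. *)
apply: (@le_trans _ _ (expR (G th - th * t))%:E); last first.
  have -> : t / c * (ln t - ln (ln t) - s2 / c) = th * t - s2 * t / c ^+ 2.
    by rewrite /th; field; rewrite gt_eqF.
  rewrite lee_fin ler_expR opprB lerD2r /G eth.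
  apply: (@le_trans _ _ (s2 * th / c * (t / ln t))).
    by rewrite ler_wpM2l ?lerBlDr ?lerDl.
  have -> : s2 * t / c ^+ 2 = s2 * (ln t / c) / c * (t / ln t).
    by field; rewrite !gt_eqF.
  rewrite ler_pM2r ?divr_gt0// ler_pM2r ?invr_gt0// ler_pM2l//.
  by rewrite ler_pM2r ?invr_gt0// gerBl.
have Pfin : P [set w | (t <= X w)%R] \is a fin_num.
  apply: fin_num_measure; rewrite -[X in measurable X]setTI.
  exact: measurable_fun_le.
rewrite -(fineK Pfin) lee_fin.
(* The probability does not depend on [s], so the bounds for [s < th] pass to the left limit at
   [th]. *)
have cF : continuous (fun s => expR (G s - s * t)).
  move=> u; apply: continuous_comp; last exact: continuous_expR.
  apply: cvgB; last by apply: cvgMl; exact: cvg_id.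
  apply: cvgMr; apply: cvgB; last exact: cvg_cst.
  apply: continuous_comp; last exact: continuous_expR.
  by apply: cvgMr; exact: cvg_id.
apply: (cvgr_to_ge (cvg_at_left_filter (cF th))).
near=> s; rewrite -lee_fin fineK//; apply: tail; apply/andP; split; near: s.
  exact: nbhs_left_gt.
exact: nbhs_left_lt.
Unshelve. all: by end_near. Qed.

End zero_bias_concentration.

(** * Simplified logarithmic bound and assembly of the theorem *)

Lemma log_tail_simplify (R : realType) (s2 c t : R) : 0 < c -> expR 1 < t ->
  expR (- (t / c * (ln t - ln (ln t) - s2 / c))) <=
  expR (- (t / (2 * c) * (ln t - 2 * s2 / c))).
Proof.
move=> c_gt0 te.
have t_gt0 : 0 < t by rewrite (lt_trans (expR_gt0 1)).
have L_gt0 : 0 < ln t.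
  by rewrite (lt_trans ltr01)// -[ltLHS]expRK ltr_ln// posrE expR_gt0.
rewrite ler_expR lerN2.
have -> : t / (2 * c) * (ln t - 2 * s2 / c) = t / c * (ln t / 2 - s2 / c).
  by field; rewrite gt_eqF.
rewrite ler_pM2l ?divr_gt0// lerD2r.
(* With [u = ln t], this is the sum of [ln (u/2) <= u/2 - 1] and [ln 2 <= 1]. *)
suff : ln (ln t) <= ln t / 2 by lra.
have ln2 : ln 2 <= 1 :> R.
  by have := @le_ln1Dx R 1; rewrite (_ : 1 + 1 = 2)//; apply; lra.
have := @le_ln1Dx R (ln t / 2 - 1); rewrite (addrC 1) subrK.
rewrite ln_div ?posrE//; lra.
Qed.

Unset Implicit Arguments.

Theorem theorem2p1 (d : measure_display) (T : measurableType d) (R : realType)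
  (P : probability T R) (Y Ys : {RV P >-> R}) (s2 : R) :
  (Y : T -> R) \in Lfun P 2%:E ->
  ('E_P[Y] = 0)%E ->
  'V_P[Y] = s2%:E ->
  0 < s2 ->
  zero_biased P Y Ys s2 ->
  (* (a) first bound, upper tail *)
  (forall c : R, 0 < c ->
    {ae P, forall w, Ys w - Y w <= c} ->
    (forall s : R, 0 <= s < c^-1 -> ('M_P Y s < +oo)%E) ->
    forall t : R, 0 <= t ->
      (P [set w | (t <= Y w)%R] <= (expR (- (t ^+ 2 / (2 * (s2 + c * t)))))%:E)%E) /\
  (* (a) first bound, lower tail *)
  (forall c : R, 0 < c ->
    {ae P, forall w, Y w - Ys w <= c} ->
    (forall s : R, - c^-1 < s <= 0 -> ('M_P Y s < +oo)%E) ->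
    forall t : R, 0 <= t ->
      (P [set w | (Y w <= - t)%R] <= (expR (- (t ^+ 2 / (2 * (s2 + c * t)))))%:E)%E) /\
  (* (a) second bound, upper tail *)
  (forall c : R, 0 < c ->
    {ae P, forall w, `|Ys w - Y w| <= c} ->
    (forall s : R, 0 <= s < 2 / c -> ('M_P Y s < +oo)%E) ->
    forall t : R, 0 <= t ->
      (P [set w | (t <= Y w)%R] <= (expR (- (t ^+ 2 / (10 * s2 / 3 + c * t))))%:E)%E) /\
  (* (a) second bound, lower tail *)
  (forall c : R, 0 < c ->
    {ae P, forall w, `|Ys w - Y w| <= c} ->
    (forall s : R, - (2 / c) < s <= 0 -> ('M_P Y s < +oo)%E) ->
    forall t : R, 0 <= t ->
      (P [set w | (Y w <= - t)%R] <= (expR (- (t ^+ 2 / (10 * s2 / 3 + c * t))))%:E)%E) /\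
  (* (b) upper tail *)
  (forall c t : R, 0 < c -> expR 1 < t ->
    {ae P, forall w, Ys w - Y w <= c} ->
    ('M_P Y ((ln t - ln (ln t)) / c) < +oo)%E ->
      (P [set w | (t <= Y w)%R] <=
         (expR (- (t / c * (ln t - ln (ln t) - s2 / c))))%:E)%E /\
      (expR (- (t / c * (ln t - ln (ln t) - s2 / c))) <=
         expR (- (t / (2 * c) * (ln t - 2 * s2 / c))))) /\
  (* (b) lower tail *)
  (forall c t : R, 0 < c -> expR 1 < t ->
    {ae P, forall w, Y w - Ys w <= c} ->
    ('M_P Y (- ((ln t - ln (ln t)) / c)) < +oo)%E ->
      (P [set w | (Y w <= - t)%R] <=
         (expR (- (t / c * (ln t - ln (ln t) - s2 / c))))%:E)%E /\
      (expR (- (t / c * (ln t - ln (ln t) - s2 / c))) <=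
         expR (- (t / (2 * c) * (ln t - 2 * s2 / c))))).
Proof.
move=> Y2 _ _ s2_gt0 /zero_biased_exp zb.
have mY : measurable_fun setT (Y : T -> R) by [].
have mYs : measurable_fun setT (Ys : T -> R) by [].
have mNY : measurable_fun setT (\- Y : T -> R) by exact: measurableT_comp.
have mNYs : measurable_fun setT (\- Ys : T -> R) by exact: measurableT_comp.
have iY : P.-integrable setT (EFin \o (Y : T -> R)).
  by apply/Lfun1_integrable; apply: Lfun_subset12 Y2; exact: fin_num_measure.
have iNY : P.-integrable setT (EFin \o (\- Y : T -> R)).
  apply: eq_integrable (integrableN iY) => // w _.
have zbN := exp_zero_biasedN zb.
(* Reflection turns finiteness of the mgf to the left of 0 into finiteness to the right, and lower
   tails into upper tails. *)
have MN s : ('M_P (\- Y)%R s = 'M_P Y (- s))%E.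
  rewrite !mmt_gen_funE; apply: eq_integral => w _ /=.
  by rewrite mulrN mulNr.
have tailN t : [set w | Y w <= - t] = [set w | t <= - Y w].
  by apply/seteqP; split => w /=; rewrite lerNr.
have aeN c : {ae P, forall w, Y w - Ys w <= c} ->
    {ae P, forall w, (\- Ys) w - (\- Y) w <= c}.
  by apply: filterS => w /=; rewrite opprK addrC.
have aeA c : {ae P, forall w, `|Ys w - Y w| <= c} ->
    {ae P, forall w, Ys w - Y w <= c} /\ {ae P, forall w, Y w - Ys w <= c}.
  move=> h; split; apply: filterS h => w; first exact: le_trans (ler_norm _).
  by rewrite distrC; exact: le_trans (ler_norm _).
split; [|split; [|split; [|split; [|split]]]].
- by move=> c c_gt0 YsY M; exact: (zero_bias_subgamma mY mYs iY zb s2_gt0 c_gt0 YsY M).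
- move=> c c_gt0 YsY M t; rewrite tailN.
  apply: (zero_bias_subgamma mNY mNYs iNY zbN s2_gt0 c_gt0 (aeN _ YsY)) => s.
  by move=> /andP[s_ge0 sc]; rewrite MN; apply: M; rewrite ltrN2 sc oppr_le0.
- by move=> c c_gt0 /aeA[YsY _] M; exact: (zero_bias_subgamma_half mY mYs iY zb s2_gt0 c_gt0 YsY M).
- move=> c c_gt0 /aeA[_ YsY] M t; rewrite tailN.
  apply: (zero_bias_subgamma_half mNY mNYs iNY zbN s2_gt0 c_gt0 (aeN _ YsY)) => s.
  by move=> /andP[s_ge0 sc]; rewrite MN; apply: M; rewrite ltrN2 sc oppr_le0.
- move=> c t c_gt0 te YsY M; split; last exact: log_tail_simplify.
  exact: (zero_bias_log_tail mY mYs iY zb s2_gt0 c_gt0 YsY te M).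
- move=> c t c_gt0 te YsY M; split; last exact: log_tail_simplify.
  by rewrite tailN; apply: (zero_bias_log_tail mNY mNYs iNY zbN s2_gt0 c_gt0 (aeN _ YsY));
    rewrite ?MN.
Qed.
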